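(* Let $d=2$. Then for every $\lambda\in\mathbb{C}$ with $\lambda\neq[V]$, the Laurent polynomial $z\mapsto\mathcal{P}(z,\lambda)$ is irreducible (it admits no factorization $fg$ into two Laurent polynomials in $z$ neither of which is a monomial). Moreover, if $\mathcal{P}(\cdot,[V])$ is reducible, then it has exactly two distinct non-monomial irreducible factors, each of multiplicity one.
   Context: Fix positive integers $q_1,q_2$ with greatest common divisor $1$, $Q=q_1q_2$, $\Gamma=q_1\mathbb{Z}\oplus q_2\mathbb{Z}$, and a $\Gamma$-periodic $V:\mathbb{Z}^2\to\mathbb{C}$. The discrete Laplacian is $(\Delta u)(n)=\sum_{\|n'-n\|_1=1}u(n')$. Let $W=\{(n_1,n_2):0\le n_j\le q_j-1\}$. For $z\in(\mathbb{C}\setminus\{0\})^2$, the space of $u:\mathbb{Z}^2\to\mathbb{C}$ with $u(n+q_je_j)=z_ju(n)$ ($j=1,2$) is identified with $\mathbb{C}^W$ by restriction; $\mathcal{D}(z)$ is the $Q\times Q$ matrix of $-\Delta+V$ on this space, and $\mathcal{P}(z,\lambda)=\det(\mathcal{D}(z)-\lambda I)$, a Laurent polynomial in $z_1,z_2$ and polynomial in $\lambda$. A monomial is $Cz_1^{a_1}z_2^{a_2}$ with $C\ne0$, $a_j\in\mathbb{Z}$. $[V]=\frac{1}{Q}\sum_{n\in W}V(n)$. *)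

(* Defs.v *)
(* The complex numbers are modelled as  R[i]  for an
   arbitrary  R : realType  (every realType is the complete archimedean
   ordered field, so R[i] is C). *)
From HB Require Import structures.
From mathcomp Require Import all_boot all_order all_algebra.
From mathcomp Require Import reals.
From mathcomp.real_closed Require Import complex.
Set Implicit Arguments.
Unset Strict Implicit.
Unset Printing Implicit Defensive.
Import Order.TTheory GRing.Theory Num.Theory.
Local Open Scope ring_scope.

Section Floquet.
Variable C : fieldType.

Definition periodic2 (q1 q2 : nat) (V : int * int -> C) : Prop :=
  forall n1 n2 : int,
    V (n1 + q1%:Z, n2) = V (n1, n2) /\ V (n1, n2 + q2%:Z) = V (n1, n2).

Definition W (q1 q2 : nat) : finType := ('I_q1 * 'I_q2)%type.

Definition unit_steps : seq (int * int) := [:: (1, 0); (-1, 0); (0, 1); (0, -1)].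

(* Matrix entry D(z)[n, w] of -Delta + V on the Floquet space
   { u | u(n + q_j e_j) = z_j u(n) }, identified with C^W by restriction:
   (Delta u)(n) = sum_e u(n+e), and writing n + e = w + k1 q1 e1 + k2 q2 e2
   with w in W (Euclidean division) gives u(n+e) = z1^k1 z2^k2 u(w). *)
Definition Dentry (q1 q2 : nat) (V : int * int -> C) (z1 z2 : C)
    (n w : W q1 q2) : C :=
  let a1 : int := (nat_of_ord n.1)%:Z in
  let a2 : int := (nat_of_ord n.2)%:Z in
  (if n == w then V (a1, a2) else 0)
  - \sum_(e <- unit_steps)
      (if ((((a1 + e.1) %% q1%:Z)%Z == (nat_of_ord w.1)%:Z) &&
           (((a2 + e.2) %% q2%:Z)%Z == (nat_of_ord w.2)%:Z))
       then z1 ^ ((a1 + e.1) %/ q1%:Z)%Z * z2 ^ ((a2 + e.2) %/ q2%:Z)%Z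
       else 0).

Definition Dmat (q1 q2 : nat) (V : int * int -> C) (z1 z2 : C)
    : 'M[C]_(#|{: W q1 q2}|) :=
  \matrix_(i, j) Dentry V z1 z2 (enum_val i) (enum_val j).

Definition Pfloq (q1 q2 : nat) (V : int * int -> C) (lam z1 z2 : C) : C :=
  \det (Dmat q1 q2 V z1 z2 - lam%:M).

Definition meanV (q1 q2 : nat) (V : int * int -> C) : C :=
  (q1 * q2)%:R^-1 *
    \sum_(n : W q1 q2) V ((nat_of_ord n.1)%:Z, (nat_of_ord n.2)%:Z).

(* Laurent polynomials in z = (z1, z2), viewed as functions on (C\{0})^2;
   since C is infinite, such a function determines the Laurent polynomial. *)
Definition laurent (f : C -> C -> C) : Prop :=
  exists s : seq ((int * int) * C),
    forall z1 z2 : C, z1 != 0 -> z2 != 0 ->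
      f z1 z2 = \sum_(t <- s) t.2 * z1 ^ t.1.1 * z2 ^ t.1.2.

Definition monomial (f : C -> C -> C) : Prop :=
  exists (c : C) (a1 a2 : int), c != 0 /\
    forall z1 z2 : C, z1 != 0 -> z2 != 0 -> f z1 z2 = c * z1 ^ a1 * z2 ^ a2.

Definition lfactors (f g h : C -> C -> C) : Prop :=
  forall z1 z2 : C, z1 != 0 -> z2 != 0 -> f z1 z2 = g z1 z2 * h z1 z2.

Definition lreducible (f : C -> C -> C) : Prop :=
  exists g h : C -> C -> C,
    [/\ laurent g, laurent h, ~ monomial g, ~ monomial h & lfactors f g h].

Definition lirreducible (f : C -> C -> C) : Prop := ~ lreducible f.

Definition lirred_elem (f : C -> C -> C) : Prop :=
  [/\ laurent f, ~ monomial f & lirreducible f].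

Definition lassociated (f g : C -> C -> C) : Prop :=
  exists m : C -> C -> C, monomial m /\ lfactors f m g.

End Floquet.

(* Main.v *)
(* Newton polygons. As a Laurent polynomial in z, P(z, lambda) is supported in the
   diamond |q1 a1 +- q2 a2| <= q1 q2, with nonzero coefficients at the vertices
   (+-q2, 0), (0, +-q1), whose edges are primitive because gcd(q1, q2) = 1. For a
   factor f, the widths of its support in the directions (q1, q2) and (q1, -q2) are
   2 q1 q2 k and 2 q1 q2 l with k, l natural numbers; they are additive, sum to 1
   over a factorization of P, and k = l = 0 means that f is a monomial. So there are
   at most two non-monomial factors, with (k, l) = (1, 0) and (0, 1), and then the
   (q1, q2)-weights occurring in P are all congruent to q1 q2 modulo 2 q1 q2.

   The substitution u(n) = w^n v(n) gives P(w1^q1, w2^q2) = det H(w), where H(w) is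
   V - lambda - sum_e w^e S_e with S_e the cyclic shifts. Take w = (1/s, -1/s): the
   coefficient of s in s^Q P vanishes by the above when P is reducible, but it equals
   Q ([V] - lambda) times the common cofactor of S_(0,1) - S_(1,0). This cofactor is
   nonzero since, q1 and q2 being coprime, the kernel of this difference consists of
   the constants. The vertex coefficients are found likewise from w = s^(-e), whose
   leading term is det(-S_e). *)
Require Import Defs.
From HB Require Import structures.
From mathcomp Require Import all_boot all_order all_algebra perm.
From mathcomp Require Import reals boolp.
From mathcomp.real_closed Require Import complex.
From mathcomp Require Import zify ring.
Set Implicit Arguments.
Unset Strict Implicit.
Unset Printing Implicit Defensive.
Import Order.TTheory GRing.Theory Num.Theory.
Local Open Scope ring_scope.

(** * Laurent polynomials and their exponents *)

Section LaurentCoefficients.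
Variable C : numFieldType.
Implicit Types (f g h : C -> C -> C) (c d : int * int -> C) (x y p : int * int).

Definition zmon (z1 z2 : C) x : C := z1 ^ x.1 * z2 ^ x.2.

Lemma zmon_neq0 z1 z2 x : z1 != 0 -> z2 != 0 -> zmon z1 z2 x != 0.
Proof. by move=> z10 z20; rewrite mulf_neq0 // expfz_neq0. Qed.

Lemma zmonD z1 z2 x y : z1 != 0 -> z2 != 0 ->
  zmon z1 z2 (x + y) = zmon z1 z2 x * zmon z1 z2 y.
Proof. by move=> z10 z20; rewrite /zmon /= !expfzDr // mulrACA. Qed.

Lemma zmonM z1 z2 w1 w2 x :
  zmon (w1 * z1) (w2 * z2) x = zmon w1 w2 x * zmon z1 z2 x.
Proof. by rewrite /zmon !expfzMl mulrACA. Qed.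

(** In characteristic zero [2 ^ n = 1] is an equation between naturals, which parity refutes for
    [n > 0]. *)
Lemma pow2z_inj : injective (fun i : int => 2%:R ^ i : C).
Proof.
have two_neq0 : 2%:R != 0 :> C by rewrite pnatr_eq0.
have pow2_eq1 (n : nat) : 2%:R ^+ n = 1 :> C -> n = 0%N.
  move=> /eqP; rewrite -natrX (eqr_nat C _ 1) => /eqP.
  by case: n => // n; rewrite expnS => /(congr1 odd); rewrite oddM.
move=> i j /= ij; apply/eqP; rewrite -subr_eq0; apply/eqP.
have : 2%:R ^ (i - j) = 1 :> C.
  by rewrite expfzDr // ij -expfzDr // subrr expr0z.
case: (i - j) => n; first by rewrite -exprnP => /pow2_eq1 ->.
by rewrite NegzE -invr_expz => /eqP; rewrite invr_eq1 => /eqP/pow2_eq1.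
Qed.

Lemma zmon_separated x y : x != y ->
  exists w1 w2 : C, [/\ w1 != 0, w2 != 0 & zmon w1 w2 x != zmon w1 w2 y].
Proof.
have two_neq0 : 2%:R != 0 :> C by rewrite pnatr_eq0.
move=> xy; have [E1|N1] := eqVneq x.1 y.1.
  exists 1, 2%:R; rewrite oner_neq0 two_neq0; split=> //.
  rewrite /zmon !exp1rz !mul1r; apply: contra xy => /eqP/pow2z_inj E2.
  by case: x y E1 E2 => [? ?] [? ?] /= -> ->.
exists 2%:R, 1; rewrite oner_neq0 two_neq0; split=> //.
by rewrite /zmon !exp1rz !mulr1; apply: contra N1 => /eqP/pow2z_inj ->.
Qed.

(* Dedekind's independence of characters: the combination F(wz) - w^y F(z)
   eliminates the character z^y. *)
Lemma zmon_independent (s : seq (int * int)) c : uniq s ->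
  (forall z1 z2, z1 != 0 -> z2 != 0 -> \sum_(x <- s) c x * zmon z1 z2 x = 0) ->
  {in s, forall x, c x = 0}.
Proof.
elim: s c => [|y s IHs] c //= /andP[yNs s_uniq] sum0.
have cs0 : {in s, forall x, c x = 0}.
  move=> x xs; have xy : x != y by apply: contraNneq yNs => <-.
  have [w1 [w2 [w10 w20 wxy]]] := zmon_separated xy.
  have /IHs : uniq s by [].
  move=> /(_ (fun u => c u * (zmon w1 w2 u - zmon w1 w2 y))) IH.
  have /eqP : c x * (zmon w1 w2 x - zmon w1 w2 y) = 0.
    apply: IH => // z1 z2 z10 z20.
    have := sum0 _ _ (mulf_neq0 w10 z10) (mulf_neq0 w20 z20).
    have /(congr1 ( *%R (zmon w1 w2 y))) := sum0 _ _ z10 z20.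
    rewrite mulr0 !big_cons mulrDr mulr_sumr => e1 e2.
    apply: etrans (etrans (congr2 (fun a b => a - b) e2 e1) (subrr 0)).
    rewrite zmonM opprD addrACA [X in _ = X + _](_ : _ = 0) ?add0r; last by ring.
    by rewrite -sumrB; apply: eq_bigr => u _; rewrite zmonM; ring.
  by rewrite mulf_eq0 subr_eq0 (negPf wxy) orbF => /eqP.
move=> x; rewrite inE => /orP[/eqP ->|/cs0 //].
(* All other coefficients being zero, evaluation at [(1, 1)] isolates the remaining one. *)
have := sum0 1 1 (oner_neq0 _) (oner_neq0 _).
rewrite big_cons big_seq big1 ?addr0 => [/eqP|u us]; last by rewrite cs0 // mul0r.
by rewrite mulf_eq0 (negPf (zmon_neq0 _ _ _)) ?oner_neq0 // orbF => /eqP.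
Qed.

(** Laurent polynomials are given as functions, so their coefficients are attached by a relation.
    The list only has to contain the support, which lets two expansions be compared on a common
    list. *)
Definition lcoefs f c := exists s : seq (int * int),
  [/\ uniq s, forall x, c x != 0 -> x \in s
    & forall z1 z2, z1 != 0 -> z2 != 0 ->
        f z1 z2 = \sum_(x <- s) c x * zmon z1 z2 x].

Lemma eq_lcoefs f g c :
  (forall z1 z2, z1 != 0 -> z2 != 0 -> f z1 z2 = g z1 z2) ->
  lcoefs f c -> lcoefs g c.
Proof.
move=> fg [s [us cs fE]]; exists s; split=> // z1 z2 z10 z20.
by rewrite -fg // fE.
Qed.

Lemma sum_supp (s t : seq (int * int)) c (F : int * int -> C) :
  uniq s -> uniq t -> {subset s <= t} -> (forall x, c x != 0 -> x \in s) ->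
  \sum_(x <- t) c x * F x = \sum_(x <- s) c x * F x.
Proof.
move=> us ut st cs; rewrite (bigID (mem s)) /= addrC big1 ?add0r => [|x xNs].
  rewrite -big_filter; apply: perm_big; apply: uniq_perm; rewrite ?filter_uniq //.
  by move=> x; rewrite mem_filter andbC; apply: andb_idl; apply: st.
by rewrite (contraNeq (cs x)) ?mul0r.
Qed.

Lemma lcoefs_uniq f c d : lcoefs f c -> lcoefs f d -> c =1 d.
Proof.
move=> [s [us cs fc]] [t [ut dt fd]] x.
pose r := undup (s ++ t).
have ur : uniq r by rewrite undup_uniq.
have sr : {subset s <= r} by move=> u us'; rewrite mem_undup mem_cat us'.
have tr : {subset t <= r} by move=> u us'; rewrite mem_undup mem_cat us' orbT.
apply/eqP; rewrite -subr_eq0; case: (boolP (x \in r)) => [xr|xNr].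
  apply/eqP; apply: (zmon_independent (s := r) (c := fun u => c u - d u)) => //.
  move=> z1 z2 z10 z20; rewrite (eq_bigr (fun u => c u * zmon z1 z2 u -
    d u * zmon z1 z2 u)) => [|u _]; last by rewrite mulrBl.
  by rewrite sumrB (sum_supp _ us ur sr cs) (sum_supp _ ut ur tr dt) -fc // -fd // subrr.
rewrite (contraNeq (cs x)) ?(contraNeq (dt x)) ?subr0 //.
  by apply: contra xNr => /tr.
by apply: contra xNr => /sr.
Qed.

Lemma lcoefs_raw f (I : Type) (r : seq I) (e : I -> int * int) (a : I -> C) :
  (forall z1 z2, z1 != 0 -> z2 != 0 ->
     f z1 z2 = \sum_(i <- r) a i * zmon z1 z2 (e i)) ->
  lcoefs f (fun p => \sum_(i <- r | e i == p) a i).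
Proof.
move=> fE; exists (undup (map e r)); split=> [|x|z1 z2 z10 z20].
- exact: undup_uniq.
- rewrite mem_undup; apply: contraNT => xNr; apply/eqP.
  elim: r xNr {fE} => [|i r IHr] /=; first by rewrite big_nil.
  rewrite inE negb_or big_cons => /andP[xi /IHr ->].
  by rewrite eq_sym (negPf xi).
rewrite fE //; move: (mem_undup (map e r)) (undup_uniq (map e r)).
move: (undup _) => s sE us.
have: {subset map e r <= s} by move=> x; rewrite sE.
clear sE fE; elim: r => [|i r IHr] rs.
  by rewrite big_nil big1 // => x _; rewrite big_nil mul0r.
rewrite big_cons IHr => [|x xr]; last by apply: rs; rewrite /= inE xr orbT.
have is_ : e i \in s by apply: rs; rewrite /= inE eqxx.
rewrite !(bigD1_seq _ is_ us) /= addrA; congr (_ + _).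
  by rewrite big_cons eqxx mulrDl.
by apply: eq_bigr => x /negPf xi; rewrite big_cons eq_sym xi.
Qed.

Lemma laurent_lcoefs f : laurent f -> exists c, lcoefs f c.
Proof.
move=> [r fE]; exists (fun p => \sum_(t <- r | t.1 == p) t.2).
apply: (lcoefs_raw (e := fst) (a := snd)) => z1 z2 z10 z20; rewrite fE //.
by apply: eq_bigr => t _; rewrite /zmon mulrA.
Qed.

(** The list of exponent pairs is kept explicit so that a single coefficient of the product can be
    examined for cancellation. *)
Lemma lcoefsM f g c d : lcoefs f c -> lcoefs g d ->
  exists s : seq ((int * int) * (int * int)),
  [/\ uniq s, forall x y, c x != 0 -> d y != 0 -> (x, y) \in s
    & lcoefs (fun z1 z2 => f z1 z2 * g z1 z2)
        (fun p => \sum_(i <- s | i.1 + i.2 == p) c i.1 * d i.2)].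
Proof.
move=> [s [us cs fE]] [t [ut dt gE]].
exists [seq (x, y) | x <- s, y <- t]; split.
- by apply: allpairs_uniq => // -[? ?] [? ?].
- by move=> x y /cs xs /dt yt; apply/allpairsP; exists (x, y).
apply: (lcoefs_raw (e := fun i => i.1 + i.2) (a := fun i => c i.1 * d i.2)).
move=> z1 z2 z10 z20; rewrite fE // gE // big_distrlr /= big_allpairs.
apply: eq_bigr => x _; apply: eq_bigr => y _; rewrite zmonD //; ring.
Qed.

Lemma lcoefsM_ex f g c d : lcoefs f c -> lcoefs g d ->
  exists e, lcoefs (fun z1 z2 => f z1 z2 * g z1 z2) e.
Proof. by move=> fc gd; have [s [_ _ fgE]] := lcoefsM fc gd; eexists; exact: fgE. Qed.

Lemma lcoefsM_supp f g h c d e p : lcoefs f c -> lcoefs g d -> lcoefs h e ->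
  lfactors h f g -> e p != 0 -> exists x y, [/\ c x != 0, d y != 0 & x + y = p].
Proof.
move=> fc gd he hfg ep; have [s [_ _ /lcoefs_uniq E]] := lcoefsM fc gd.
have {}E := E _ (eq_lcoefs hfg he).
move: ep; rewrite -E; have [/hasP[[x y] _ /=]|/hasPn no] :=
  boolP (has (fun i => [&& c i.1 != 0, d i.2 != 0 & i.1 + i.2 == p]) s).
  by case/and3P=> cx dy /eqP xyp; exists x, y.
rewrite big_seq_cond big1 ?eqxx // => i /andP[/no + ip].
by rewrite ip andbT negb_and !negbK => /orP[]/eqP ->; rewrite ?mul0r ?mulr0.
Qed.

(** Only one pair of exponents has the sum [x + y], so its contribution cannot cancel. *)
Lemma lcoefsM_extreme f g h c d e x y : lcoefs f c -> lcoefs g d -> lcoefs h e ->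
  lfactors h f g -> c x != 0 -> d y != 0 ->
  (forall x' y', c x' != 0 -> d y' != 0 -> x' + y' = x + y -> x' = x) ->
  e (x + y) != 0.
Proof.
move=> fc gd he hfg cx dy ext; have [s [us ms /lcoefs_uniq E]] := lcoefsM fc gd.
have {}E := E _ (eq_lcoefs hfg he).
rewrite -E big_mkcond (bigD1_seq (x, y)) ?ms //= eqxx big1 => [|i ixy].
  by rewrite addr0 mulf_neq0.
case: eqP => // Ei; apply/eqP; rewrite mulf_eq0; apply: contraNT ixy.
rewrite negb_or => /andP[ci di]; have E1 := ext _ _ ci di Ei.
case: i E1 Ei {ci di} => [i j] /= -> /addrI -> //.
Qed.

(** * Support functions of Newton polygons *)

Definition weight (a b : int) x : int := a * x.1 + b * x.2.

Lemma weightD a b x y : weight a b (x + y) = weight a b x + weight a b y.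
Proof. rewrite /weight /=; ring. Qed.

(** This is the value at [(a, b)] of the support function of the Newton polygon. *)
Definition top (a b : int) c (m : int) :=
  (exists2 x, c x != 0 & weight a b x = m) /\
  forall x, c x != 0 -> weight a b x <= m.

Lemma seq_max (T : eqType) (s : seq T) (P : pred T) (F : T -> int) (x : T) :
  x \in s -> P x ->
  exists y : T, [/\ y \in s, P y & forall u, u \in s -> P u -> F u <= F y].
Proof.
elim: s x => [//|a s IHs] x.
have [/hasP[y ys Py] _ _|/hasPn no] := boolP (has P s).
  have [v [vs Pv mv]] := IHs y ys Py.
  have [av|va] := leP (F a) (F v).
    exists v; rewrite inE vs orbT; split=> // u; rewrite inE => /orP[/eqP->|] //.
    exact: mv.
  have [Pa|NPa] := boolP (P a).
    exists a; rewrite inE eqxx; split=> // u; rewrite inE => /orP[/eqP->|us Pu] //.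
    by apply: le_trans (mv u us Pu) (ltW va).
  exists v; rewrite inE vs orbT; split=> // u; rewrite inE => /orP[/eqP->|us Pu].
    by rewrite (negPf NPa).
  exact: mv.
rewrite inE => /orP[/eqP->|/no/negP//] Pa; exists a; rewrite inE eqxx; split=> // u.
by rewrite inE => /orP[/eqP->|/no/negP] //.
Qed.

(** The predicate [P] allows a second maximization, along a face of the Newton polygon. *)
Lemma lcoefs_max f c (P : pred (int * int)) (F : int * int -> int) x :
  lcoefs f c -> c x != 0 -> P x ->
  exists y, [/\ c y != 0, P y & forall u, c u != 0 -> P u -> F u <= F y].
Proof.
move=> [s [_ cs _]] cx Px.
have cPx : (fun u => (c u != 0) && P u) x by rewrite cx.
have := seq_max (P := fun u => (c u != 0) && P u) F (cs x cx) cPx.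
move=> [y [ys /andP[cy Py] my]]; exists y; split=> // u cu Pu.
by apply: my; rewrite ?cs ?cu.
Qed.

Lemma top_ex a b f c x : lcoefs f c -> c x != 0 -> exists m, top a b c m.
Proof.
move=> fc cx; have [y [cy _ my]] :=
  lcoefs_max (P := predT) (weight a b) fc cx isT.
by exists (weight a b y); split=> [|u cu]; [exists y | apply: my].
Qed.

Lemma top_inj a b c m m' : top a b c m -> top a b c m' -> m = m'.
Proof.
move=> [[x cx <-] mx] [[y cy <-] my]; apply/eqP.
by rewrite eq_le mx ?my.
Qed.

(* The lexicographically maximal exponents (for the weight, then for the first
   coordinate) of the factors add up to an exponent that arises only once. *)
Lemma topM a b f g h c d e m n : b != 0 ->
  lcoefs f c -> lcoefs g d -> lcoefs h e -> lfactors h f g ->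
  top a b c m -> top a b d n -> top a b e (m + n).
Proof.
move=> b0 fc gd he hfg [[x0 cx0 wx0] mx] [[y0 dy0 wy0] my]; split; last first.
  move=> p /(lcoefsM_supp fc gd he hfg)[x [y [cx dy <-]]].
  by rewrite weightD lerD ?mx ?my.
have [x [cx /eqP wx lx]] := lcoefs_max (P := fun u => weight a b u == m)
  (fun u => u.1) fc cx0 (introT eqP wx0).
have [y [dy /eqP wy ly]] := lcoefs_max (P := fun u => weight a b u == n)
  (fun u => u.1) gd dy0 (introT eqP wy0).
exists (x + y); last by rewrite weightD wx wy.
apply: (lcoefsM_extreme fc gd he hfg) => // x' y' cx' dy' E.
have := mx _ cx'; have := my _ dy'; have := lx _ cx'; have := ly _ dy'.
have : weight a b (x' + y') = m + n by rewrite E weightD wx wy.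
have : (x' + y').1 = (x + y).1 by rewrite E.
rewrite weightD /= => e1 ew ly' lx' ley lex.
have wx' : weight a b x' = m by lia.
have wy' : weight a b y' = n by lia.
move: (lx' (introT eqP wx')) (ly' (introT eqP wy')) => lx1 ly1.
have x1 : x'.1 = x.1 by lia.
(* As [b] is nonzero, the weight and the first coordinate determine the exponent. *)
move: wx' wx; rewrite /weight x1 => <- /addrI /(mulfI b0).
by case: x x' x1 {cx lx cx' E lx' lx1 e1 wy ew lex} => [? ?] [? ?] /= -> ->.
Qed.

Lemma monomialP f c : lcoefs f c ->
  monomial f <-> exists2 x, c x != 0 & forall y, c y != 0 -> y = x.
Proof.
move=> fc; split=> [[k [a1 [a2 [k0 fE]]]]|[x cx mx]].
  have /lcoefs_uniq/(_ fc) cE : lcoefs f (fun p => \sum_(i <- [:: (a1, a2)] | i == p) k).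
    apply: (lcoefs_raw (e := id) (a := fun=> k)) => z1 z2 z10 z20.
    by rewrite big_seq1 fE // /zmon mulrA.
  exists (a1, a2) => [|y]; rewrite -cE big_mkcond big_seq1 ?eqxx //.
  by case: ((a1, a2) =P y) => [<-|_] //; rewrite eqxx.
case: fc => s [us cs fE]; exists (c x), x.1, x.2; split=> // z1 z2 z10 z20.
rewrite fE // (bigD1_seq x) ?cs //= big1 ?addr0 ?mulrA // => y yx.
suff /eqP -> : c y == 0 by rewrite mul0r.
by apply: contraNT yx => /mx ->.
Qed.

End LaurentCoefficients.
(** * Factorizations of a diamond-shaped Laurent polynomial *)

Section NewtonDiamond.
Variable C : numFieldType.
Implicit Types (f g h : C -> C -> C) (c d : int * int -> C) (x y : int * int).

(** The maximum of the opposite weight is minus the minimum, so the sum is the length of the range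
    of weights. *)
Definition width (a b : int) c (w : int) :=
  exists m n, [/\ top a b c m, top (- a) (- b) c n & w = m + n].

Lemma width_inj a b c w w' : width a b c w -> width a b c w' -> w = w'.
Proof.
move=> [m [n [cm cn ->]]] [m' [n' [cm' cn' ->]]].
by rewrite (top_inj cm cm') (top_inj cn cn').
Qed.

Lemma widthM a b f g h c d e w w' : b != 0 ->
  lcoefs f c -> lcoefs g d -> lcoefs h e -> lfactors h f g ->
  width a b c w -> width a b d w' -> width a b e (w + w').
Proof.
move=> b0 fc gd he hfg [m [n [cm cn ->]]] [m' [n' [cm' cn' ->]]].
exists (m + m'), (n + n'); split; last by rewrite addrACA.
  exact: (topM b0 fc gd he hfg).
by apply: (topM _ fc gd he hfg); rewrite ?oppr_eq0.
Qed.

Lemma weightN a b x : weight (- a) (- b) x = - weight a b x.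
Proof. rewrite /weight; ring. Qed.

Lemma width0 a b c : width a b c 0 ->
  exists m, forall x, c x != 0 -> weight a b x = m.
Proof.
move=> [m [n [[_ cm] [_ cn] mn]]]; exists m => x cx.
by have := cm x cx; have := cn x cx; rewrite weightN; lia.
Qed.

Variables q1 q2 : nat.
Hypotheses (q1_gt0 : (0 < q1)%N) (q2_gt0 : (0 < q2)%N) (q12 : coprime q1 q2).

(** The signs are integers of absolute value 1: the four choices of [(s1, s2)] give the four
    half-planes, and the last two clauses the four vertices of their intersection. *)
Definition diamond e :=
  [/\ forall s1 s2 : int, `|s1| = 1 -> `|s2| = 1 ->
        forall x, e x != 0 -> weight (s1 * q1%:Z) (s2 * q2%:Z) x <= q1%:Z * q2%:Z,
      forall s : int, `|s| = 1 -> e (s * q2%:Z, 0) != 0 :> C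
    & forall s : int, `|s| = 1 -> e (0, s * q1%:Z) != 0].

Variables (P : C -> C -> C) (e : int * int -> C).
Hypotheses (Pe : lcoefs P e) (e_diamond : diamond e).

Lemma diamond_top (s1 s2 : int) : `|s1| = 1 -> `|s2| = 1 ->
  top (s1 * q1%:Z) (s2 * q2%:Z) e (q1%:Z * q2%:Z).
Proof.
have [supp vert _] := e_diamond; move=> s1_1 s2_1; split; last exact: supp.
exists (s1 * q2%:Z, 0); first exact: vert.
have ss : s1 * s1 = 1 by nia.
by rewrite /weight /= mulr0 addr0 mulrACA ss mul1r.
Qed.

(** The maxima of the factors add up to that of [P], so a sum that attains the latter has both
    summands maximal. *)
Lemma factor_vertex (s1 s2 : int) f g c d m n x y : `|s1| = 1 -> `|s2| = 1 ->
  lcoefs f c -> lcoefs g d -> lfactors P f g ->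
  top (s1 * q1%:Z) (s2 * q2%:Z) c m -> top (s1 * q1%:Z) (s2 * q2%:Z) d n ->
  c x != 0 -> d y != 0 ->
  weight (s1 * q1%:Z) (s2 * q2%:Z) (x + y) = q1%:Z * q2%:Z ->
  weight (s1 * q1%:Z) (s2 * q2%:Z) x = m.
Proof.
move=> s1_1 s2_1 fc gd Pfg cm dn cx dy.
have s20 : s2 * q2%:Z != 0 by rewrite mulf_neq0 //; lia.
rewrite (top_inj (diamond_top s1_1 s2_1) (topM s20 fc gd Pe Pfg cm dn)) weightD.
case: cm dn => [_ /(_ x cx) cm] [_ /(_ y dy) dn]; lia.
Qed.

Lemma edge_direction (s d1 d2 : int) : `|s| = 1 ->
  q1%:Z * d1 = s * q2%:Z * d2 -> exists j : int, d1 = q2%:Z * j.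
Proof.
move=> s1 E; have : (q2%:Z %| q1%:Z * d1)%Z.
  by rewrite E -mulrA mulrCA dvdz_mulr.
rewrite Gauss_dvdzr; last by rewrite coprimezE coprime_sym.
by case/dvdzP => j ->; exists j; rewrite mulrC.
Qed.

(** The vertices [(0, s q1)] and [(- q2, 0)] span an edge of the diamond. Their parts [x2], [x3] in
    [f] lie on the parallel face of [f], so [x2 - x3] is a multiple of the primitive edge vector. In
    the direction [(q1, s q2)] the weight is maximal at [x2] and minimal at [x3], so the width is
    the weight of this multiple. *)
Lemma factor_width (s : int) f g c d : `|s| = 1 ->
  lcoefs f c -> lcoefs g d -> lfactors P f g ->
  exists k : nat, width q1%:Z (s * q2%:Z) c (2%:Z * (q1%:Z * q2%:Z) * k%:Z).
Proof.
move=> s_1 fc gd Pfg; have [_ hor ver] := e_diamond.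
have sN1 : `|- s| = 1 by rewrite normrN.
have n1 : `|1 : int| = 1 by []. have nN1 : `|-1 : int| = 1 by [].
have [x2 [y2 [cx2 dy2 v2]]] := lcoefsM_supp fc gd Pe Pfg (ver s s_1).
have [x3 [y3 [cx3 dy3 v3]]] := lcoefsM_supp fc gd Pe Pfg (hor _ nN1).
have [m1 cm1] := top_ex (1 * q1%:Z) (s * q2%:Z) fc cx2.
have [l1 dl1] := top_ex (1 * q1%:Z) (s * q2%:Z) gd dy2.
have [m3 cm3] := top_ex (-1 * q1%:Z) (- s * q2%:Z) fc cx2.
have [l3 dl3] := top_ex (-1 * q1%:Z) (- s * q2%:Z) gd dy2.
have [m4 cm4] := top_ex (-1 * q1%:Z) (s * q2%:Z) fc cx2.
have [l4 dl4] := top_ex (-1 * q1%:Z) (s * q2%:Z) gd dy2.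
have ss : s * s = 1 by nia.
have wv (a : int) : weight a (s * q2%:Z) (x2 + y2) = q1%:Z * q2%:Z.
  by rewrite v2 /weight /= mulr0 add0r mulrACA ss mul1r mulrC.
have wh (b : int) : weight (-1 * q1%:Z) b (x3 + y3) = q1%:Z * q2%:Z.
  by rewrite v3 /weight /= mulr0 addr0 mulrACA mulrNN !mul1r.
have e1 := factor_vertex n1 s_1 fc gd Pfg cm1 dl1 cx2 dy2 (wv _).
have e2 := factor_vertex nN1 s_1 fc gd Pfg cm4 dl4 cx2 dy2 (wv _).
have e3 := factor_vertex nN1 sN1 fc gd Pfg cm3 dl3 cx3 dy3 (wh _).
have e4 := factor_vertex nN1 s_1 fc gd Pfg cm4 dl4 cx3 dy3 (wh _).
(* A width is nonnegative, which makes the multiple [j] a natural number. *)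
have m13 : 0 <= m1 + m3.
  by case: cm3 => _ /(_ x2 cx2); rewrite -e1 /weight; lia.
have [|j xj] := @edge_direction s (x2.1 - x3.1) (x2.2 - x3.2) s_1.
  by move: e2 e4; rewrite /weight; lia.
have mj : m1 + m3 = 2%:Z * (q1%:Z * q2%:Z) * j.
  rewrite -2!mulrA -xj; move: e1 e2 e3 e4; rewrite /weight => e1 e2 e3 e4; lia.
have Q0 : 0 < q1%:Z * q2%:Z by rewrite mulr_gt0.
have j0 : 0 <= j by nia.
exists `|j|%N; exists m1, m3; split.
- by rewrite -[X in top X]mul1r.
- by move: cm3; rewrite mulN1r mulNr.
- by rewrite mj gez0_abs.
Qed.

Lemma factor_nonzero f g c d : lcoefs f c -> lcoefs g d -> lfactors P f g ->
  exists x, c x != 0.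
Proof.
move=> fc gd Pfg; have [_ hor _] := e_diamond.
have [x [y [cx _ _]]] := lcoefsM_supp fc gd Pe Pfg (hor 1 erefl).
by exists x.
Qed.

(** The two directions are linearly independent, so fixing both weights fixes the exponent. *)
Lemma width0_monomial f c x : lcoefs f c -> c x != 0 ->
  width q1%:Z (1 * q2%:Z) c 0 -> width q1%:Z (-1 * q2%:Z) c 0 -> monomial f.
Proof.
move=> fc cx /width0[m cm] /width0[n cn]; apply/(monomialP fc).
exists x => // y cy; have := cm _ cx; have := cn _ cx.
have := cm _ cy; have := cn _ cy; rewrite /weight => w1 w2 w3 w4.
have e1 : q1%:Z * y.1 = q1%:Z * x.1 by lia.
have e2 : q2%:Z * y.2 = q2%:Z * x.2 by lia.
have q10 : q1%:Z != 0 by lia.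
have q20 : q2%:Z != 0 by lia.
move: (mulfI q10 e1) (mulfI q20 e2).
by case: x y {cx cy e1 e2 w1 w2 w3 w4} => [? ?] [? ?] /= -> ->.
Qed.

Lemma diamond_width (s : int) : `|s| = 1 ->
  width q1%:Z (s * q2%:Z) e (2%:Z * (q1%:Z * q2%:Z)).
Proof.
move=> s1; exists (q1%:Z * q2%:Z), (q1%:Z * q2%:Z); split.
- by have := diamond_top (s1 := 1) erefl s1; rewrite mul1r.
- by rewrite -[- q1%:Z]mulN1r -mulNr; apply: diamond_top; rewrite // normrN.
- lia.
Qed.

Lemma nonmonomial_width f g c d : lcoefs f c -> lcoefs g d -> lfactors P f g ->
  ~ monomial f -> exists k l : nat,
  [/\ width q1%:Z (1 * q2%:Z) c (2%:Z * (q1%:Z * q2%:Z) * k%:Z),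
      width q1%:Z (-1 * q2%:Z) c (2%:Z * (q1%:Z * q2%:Z) * l%:Z) & (0 < k + l)%N].
Proof.
move=> fc gd Pfg fN.
have [k ck] := factor_width (s := 1) erefl fc gd Pfg.
have [l cl] := factor_width (s := -1) erefl fc gd Pfg.
exists k, l; split=> //; rewrite lt0n addn_eq0; apply/negP => /andP[/eqP k0 /eqP l0].
have [x cx] := factor_nonzero fc gd Pfg.
by apply: fN; apply: (width0_monomial fc cx); [move: ck | move: cl];
  rewrite ?k0 ?l0 mulr0.
Qed.

Let Q_neq0 : 2%:Z * (q1%:Z * q2%:Z) != 0.
Proof. by rewrite !mulf_neq0 //; lia. Qed.

Let sq2_neq0 (s : int) : `|s| = 1 -> s * q2%:Z != 0.
Proof. by move=> s1; rewrite mulf_neq0 //; lia. Qed.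

Lemma factor_width_sum (s : int) f g c d (k l : nat) : `|s| = 1 ->
  lcoefs f c -> lcoefs g d -> lfactors P f g ->
  width q1%:Z (s * q2%:Z) c (2%:Z * (q1%:Z * q2%:Z) * k%:Z) ->
  width q1%:Z (s * q2%:Z) d (2%:Z * (q1%:Z * q2%:Z) * l%:Z) -> (k + l = 1)%N.
Proof.
move=> s1 fc gd Pfg ck dl.
have := width_inj (diamond_width s1) (widthM (sq2_neq0 s1) fc gd Pe Pfg ck dl).
by rewrite -mulrDr -[X in X = _]mulr1 => /(mulfI Q_neq0) /eqP; rewrite -PoszD; lia.
Qed.

Lemma two_factors_width f g c d : lcoefs f c -> lcoefs g d -> lfactors P f g ->
  ~ monomial f -> ~ monomial g ->
  (width q1%:Z (1 * q2%:Z) c 0 /\ width q1%:Z (-1 * q2%:Z) d 0) \/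
  (width q1%:Z (1 * q2%:Z) d 0 /\ width q1%:Z (-1 * q2%:Z) c 0).
Proof.
move=> fc gd Pfg fN gN.
have Pgf : lfactors P g f by move=> z1 z2 z10 z20; rewrite mulrC Pfg.
have [k [l [ck cl kl]]] := nonmonomial_width fc gd Pfg fN.
have [k' [l' [dk dl kl']]] := nonmonomial_width gd fc Pgf gN.
have sk := factor_width_sum (s := 1) erefl fc gd Pfg ck dk.
have sl := factor_width_sum (s := -1) erefl fc gd Pfg cl dl.
(* From [k + k' = 1], [l + l' = 1], [k + l > 0] and [k' + l' > 0], each factor takes exactly one of
   the two widths. *)
have [[k0 l0]|[k0 l0]] : (k = 0 /\ l' = 0 \/ k' = 0 /\ l = 0)%N by lia.
  by left; move: ck dl; rewrite k0 l0 mulr0.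
by right; move: dk cl; rewrite k0 l0 mulr0.
Qed.

(** Three non-monomial factors would use at least three units of width, while the two directions
    together offer two. *)
Lemma three_factors f g h : laurent f -> laurent g -> laurent h ->
  lfactors P f (fun z1 z2 => g z1 z2 * h z1 z2) ->
  [\/ monomial f, monomial g | monomial h].
Proof.
move=> /laurent_lcoefs[c fc] /laurent_lcoefs[d gd] /laurent_lcoefs[b hb] Pfgh.
have [t ghT] := lcoefsM_ex gd hb.
have [u fhT] := lcoefsM_ex fc hb.
have [v fgT] := lcoefsM_ex fc gd.
have Pgfh : lfactors P g (fun z1 z2 => f z1 z2 * h z1 z2).
  by move=> z1 z2 z10 z20; rewrite Pfgh // mulrCA.
have Phfg : lfactors P h (fun z1 z2 => f z1 z2 * g z1 z2).
  by move=> z1 z2 z10 z20; rewrite Pfgh // mulrA mulrC.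

have [|fN] := EM (monomial f); first by constructor 1.
have [|gN] := EM (monomial g); first by constructor 2.
have [|hN] := EM (monomial h); first by constructor 3.
have [k1 [l1 [ck cl kl1]]] := nonmonomial_width fc ghT Pfgh fN.
have [k2 [l2 [dk dl kl2]]] := nonmonomial_width gd fhT Pgfh gN.
have [k3 [l3 [bk bl kl3]]] := nonmonomial_width hb fgT Phfg hN.
have ghE : lfactors (fun z1 z2 => g z1 z2 * h z1 z2) g h by [].
have := factor_width_sum (s := 1) (k := k1) (l := k2 + k3) erefl fc ghT Pfgh ck.
have := factor_width_sum (s := -1) (k := l1) (l := l2 + l3) erefl fc ghT Pfgh cl.
rewrite !PoszD !mulrDr => Hl Hk.
have := Hl (widthM (@sq2_neq0 (-1) erefl) gd hb ghT ghE dl bl).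
have := Hk (widthM (@sq2_neq0 1 erefl) gd hb ghT ghE dk bk).
lia.
Qed.

(** Splitting [f] further would yield three non-monomial factors of [P]. *)
Lemma factor_irred f g : laurent f -> laurent g -> lfactors P f g ->
  ~ monomial f -> ~ monomial g -> lirred_elem f.
Proof.
move=> fL gL Pfg fN gN; split=> // -[f1 [f2 [f1L f2L f1N f2N ff]]].
have : lfactors P f1 (fun z1 z2 => f2 z1 z2 * g z1 z2).
  by move=> z1 z2 z10 z20; rewrite Pfg // ff // mulrA.
by case/(three_factors f1L f2L gL).
Qed.

Lemma monomial_width a b f c : lcoefs f c -> monomial f -> width a b c 0.
Proof.
move=> fc /(monomialP fc)[x cx mx].
exists (weight a b x), (weight (- a) (- b) x); split; last by rewrite weightN subrr.
  by split=> [|y /mx -> //]; exists x.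
by split=> [|y /mx -> //]; exists x.
Qed.

(** Monomials have width zero, so associates have equal widths; but [k + k' = 1] excludes
    [k = k']. *)
Lemma factors_nonassociated f g : laurent f -> laurent g -> lfactors P f g ->
  ~ monomial f -> ~ monomial g -> ~ lassociated f g.
Proof.
move=> fL gL Pfg fN gN [m [mM fmg]].
have [c fc] := laurent_lcoefs fL; have [d gd] := laurent_lcoefs gL.
have [b mb] : exists b, lcoefs m b.
  case: mM => k [a1 [a2 [_ mE]]]; eexists.
  apply: (lcoefs_raw (r := [:: (a1, a2)]) (e := id) (a := fun=> k)) => z1 z2 z10 z20.
  by rewrite big_seq1 mE // /zmon mulrA.
have Pgf : lfactors P g f by move=> z1 z2 z10 z20; rewrite mulrC Pfg.
have wE a a' w : a' != 0 -> width a a' d w -> width a a' c w.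
  move=> a'0 dw; rewrite -[w]add0r.
  exact: (widthM a'0 mb gd fc fmg (monomial_width _ _ mb mM)).
have [k [l [ck cl kl]]] := nonmonomial_width fc gd Pfg fN.
have [k' [l' [dk dl kl']]] := nonmonomial_width gd fc Pgf gN.
have sk := factor_width_sum (s := 1) erefl fc gd Pfg ck dk.
have := width_inj ck (wE _ _ _ (@sq2_neq0 1 erefl) dk).
by move=> /(mulfI Q_neq0) /eqP; lia.
Qed.

Lemma reducible_weights f g : laurent f -> laurent g -> lfactors P f g ->
  ~ monomial f -> ~ monomial g -> forall p, e p != 0 ->
  exists j : int, weight q1%:Z q2%:Z p = q1%:Z * q2%:Z + 2%:Z * (q1%:Z * q2%:Z) * j.
Proof.
move=> fL gL Pfg fN gN.
(* By symmetry [f] is the factor on which the weight [(q1, q2)] is constant, and [g] the one on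
   which [(q1, - q2)] is. *)
wlog [c [d [fc gd cw dw]]] : f g fL gL Pfg fN gN / exists c d,
    [/\ lcoefs f c, lcoefs g d, width q1%:Z (1 * q2%:Z) c 0
      & width q1%:Z (-1 * q2%:Z) d 0].
  move=> H; have [c fc] := laurent_lcoefs fL; have [d gd] := laurent_lcoefs gL.
  have [[cw dw]|[dw cw]] := two_factors_width fc gd Pfg fN gN.
    by apply: (H f g) => //; exists c, d.
  apply: (H g f) => //; last by exists d, c.
  by move=> z1 z2 z10 z20; rewrite mulrC Pfg.
have [_ hor _] := e_diamond.
(* The vertex [(q2, 0)], of weight [q1 q2], serves as reference. Relative to it only the part in [g]
   changes the weight, by moving along an edge direction. *)
have [x [y [cx dy v]]] := lcoefsM_supp fc gd Pe Pfg (hor 1 erefl).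
have [m cm] := width0 cw; have [n dn] := width0 dw.
move=> p /(lcoefsM_supp fc gd Pe Pfg)[x' [y' [cx' dy' <-]]].
have e1 := cm _ cx; have e2 := cm _ cx'; have e3 := dn _ dy; have e4 := dn _ dy'.
have [|j yj] := @edge_direction 1 (y'.1 - y.1) (y'.2 - y.2) erefl.
  by move: e3 e4; rewrite /weight; lia.
exists j; rewrite -2!mulrA -yj weightD.
have : weight q1%:Z q2%:Z (x + y) = q1%:Z * q2%:Z.
  by rewrite v /weight /= mul1r mulr0 addr0.
rewrite weightD; move: e1 e2 e3 e4; rewrite /weight; lia.
Qed.

End NewtonDiamond.
(** * The Floquet determinant *)

Section Determinants.

(** * Derivatives of polynomial determinants *)

Lemma deriv_prod (C : comNzRingType) (I : eqType) (r : seq I) (F : I -> {poly C}) :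
  uniq r ->
  (\prod_(i <- r) F i)^`() =
  \sum_(i <- r) (F i)^`() * \prod_(j <- r | j != i) F j.
Proof.
elim: r => [|a r IHr] /=; first by rewrite !big_nil -[1]/(1%:P) derivC.
move=> /andP[aNr ur]; rewrite !big_cons derivM IHr // eqxx; congr (_ * _ + _).
  rewrite [RHS]big_seq_cond big_seq; apply: eq_bigl => i.
  by case: eqP => [->|]; rewrite ?(negPf aNr) ?andbF ?andbT.
rewrite mulr_sumr; apply: eq_big_seq => i ir.
by rewrite big_cons mulrCA; case: eqP => // ai; rewrite ai ir in aNr.
Qed.

Lemma eq_cofactor_row (C : comPzRingType) n (A B : 'M[C]_n) k j :
  (forall i j', i != k -> A i j' = B i j') -> cofactor A k j = cofactor B k j.
Proof.
move=> AB; congr (_ * \det _); apply/matrixP => i' j'.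
by rewrite !mxE AB // eq_sym neq_lift.
Qed.

(** Jacobi's formula. The product rule in the Leibniz expansion gives a sum of determinants with one
    row differentiated, each expanded along that row. *)
Lemma deriv_det (C : comNzRingType) n (A : 'M[{poly C}]_n) :
  (\det A)^`() = \sum_k \sum_j (A k j)^`() * cofactor A k j.
Proof.
transitivity (\sum_k \det (\matrix_(i, j) if i == k then (A i j)^`() else A i j)).
  rewrite /determinant raddf_sum exchange_big /=; apply: eq_bigr => s _.
  rewrite -mulr_sumr derivM; set d := ((-1) ^+ s)^`(); have -> : d = 0.
    by rewrite /d; case: (odd_perm s); rewrite ?expr0 ?expr1 ?derivN -[1]/(1%:P) derivC ?oppr0.
  rewrite mul0r add0r deriv_prod ?index_enum_uniq //; congr (_ * _).
  apply: eq_bigr => k _; rewrite [RHS](bigD1 k) //= mxE eqxx; congr (_ * _).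
  by apply: eq_bigr => i ik; rewrite mxE (negPf ik).
apply: eq_bigr => k _; rewrite (expand_det_row _ k); apply: eq_bigr => j _.
rewrite mxE eqxx; congr (_ * _); apply: eq_cofactor_row => i j' ik.
by rewrite mxE (negPf ik).
Qed.

Lemma eq_poly_nonzero (C : numFieldType) (p q : {poly C}) :
  (forall s, s != 0 -> p.[s] = q.[s]) -> p = q.
Proof.
move=> pq; apply/eqP; rewrite -subr_eq0; apply/negPn/negP => pq0.
(* A nonzero difference would have as many distinct roots as its size, one more than its degree. *)
pose rs : seq C := [seq i.+1%:R | i <- iota 0 (size (p - q))].
have /(max_poly_roots pq0) : all (root (p - q)) rs.
  apply/allP => _ /mapP[i _ ->].
  by rewrite rootE !hornerE pq ?subrr // pnatr_eq0.
rewrite size_map size_iota ltnn map_inj_uniq ?iota_uniq; first by move=> /(_ isT).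
by move=> i j /eqP; rewrite eqr_nat => /eqP[].
Qed.

End Determinants.

Section FloquetMatrix.
Variables (C : numFieldType) (q1 q2 : nat).
Hypotheses (q1_gt0 : (0 < q1)%N) (q2_gt0 : (0 < q2)%N).

(** * Reduction of the lattice modulo the periods *)

Lemma ordz_subproof q (q_gt0 : (0 < q)%N) (x : int) : (`|(x %% q%:Z)%Z|%N < q)%N.
Proof.
have q0 : q%:Z != 0 by lia.
have := modz_ge0 x q0; have := ltz_mod x q0; lia.
Qed.

Definition ordz q (q_gt0 : (0 < q)%N) (x : int) : 'I_q :=
  Ordinal (ordz_subproof q_gt0 x).

Definition modW (x : int * int) : W q1 q2 := (ordz q1_gt0 x.1, ordz q2_gt0 x.2).
Definition divW (x : int * int) : int * int := ((x.1 %/ q1%:Z)%Z, (x.2 %/ q2%:Z)%Z).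
Definition posW (n : W q1 q2) : int * int :=
  ((nat_of_ord n.1)%:Z, (nat_of_ord n.2)%:Z).

Lemma posW_modW x : posW (modW x) = ((x.1 %% q1%:Z)%Z, (x.2 %% q2%:Z)%Z).
Proof. by rewrite /posW /= !gez0_abs // modz_ge0 //; lia. Qed.

Lemma posW_inj : injective posW.
Proof.
move=> [n1 n2] [m1 m2] [e1 e2].
by congr (_, _); apply: val_inj.
Qed.

Lemma modWE x (w : W q1 q2) :
  ((x.1 %% q1%:Z)%Z == (nat_of_ord w.1)%:Z) &&
  ((x.2 %% q2%:Z)%Z == (nat_of_ord w.2)%:Z) = (modW x == w).
Proof. by rewrite -(inj_eq posW_inj) posW_modW. Qed.

Lemma posWK n : modW (posW n) = n.
Proof.
apply: posW_inj; rewrite posW_modW /posW /=.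
by congr (_, _); rewrite modz_small //= ltz_nat ltn_ord.
Qed.

Lemma modWD x y : modW (posW (modW x) + y) = modW (x + y).
Proof. by apply: posW_inj; rewrite !posW_modW /= !modzDml. Qed.

Lemma divW_eq x : x = posW (modW x) + (q1%:Z * (divW x).1, q2%:Z * (divW x).2).
Proof.
rewrite posW_modW /divW [LHS]surjective_pairing [RHS]surjective_pairing /=.
by congr (_, _); rewrite addrC mulrC -divz_eq.
Qed.

Lemma modW_shift_inj e : injective (fun n => modW (posW n + e)).
Proof.
move=> n m /(congr1 (fun k => modW (posW k - e))).
by rewrite !modWD !addrK !posWK.
Qed.

Lemma cardW : #|{: W q1 q2}| = (q1 * q2)%N.
Proof. by rewrite card_prod !card_ord. Qed.

Lemma sum_enum_val (F : W q1 q2 -> C) :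
  \sum_(i < #|{: W q1 q2}|) F (enum_val i) = \sum_n F n.
Proof. by rewrite -(big_enum_val (A := W q1 q2)). Qed.

Lemma DentryE V z1 z2 (n w : W q1 q2) : Dentry V z1 z2 n w =
  (if n == w then V (posW n) else 0) - \sum_(e <- unit_steps)
    (if modW (posW n + e) == w then zmon z1 z2 (divW (posW n + e)) else 0) :> C.
Proof. by congr (_ - _); apply: eq_bigr => e _; rewrite -modWE. Qed.

(** * The support of the determinant *)

Lemma unit_stepP e : e \in unit_steps ->
  [\/ e = (1, 0), e = (-1, 0), e = (0, 1) | e = (0, -1)].
Proof.
rewrite !inE => /or4P[] /eqP ->;
  [constructor 1|constructor 2|constructor 3|constructor 4]; by [].
Qed.

(** Booleans encode the signs of the four diagonal directions. [sgW] measures lattice sites and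
    [sgWq] exponents of [z], where one power of [z_j] stands for a translation by [q_j]. *)
Definition sgW (b : bool * bool) : int * int -> int :=
  weight ((-1) ^+ b.1) ((-1) ^+ b.2).
Definition sgWq (b : bool * bool) : int * int -> int :=
  weight ((-1) ^+ b.1 * q1%:Z) ((-1) ^+ b.2 * q2%:Z).

Lemma sgWqE b x : sgWq b x = sgW b (q1%:Z * x.1, q2%:Z * x.2).
Proof. by rewrite /sgWq /sgW /weight /= !mulrA. Qed.

Lemma sgWD b x y : sgW b (x + y) = sgW b x + sgW b y.
Proof. exact: weightD. Qed.

(** Bounding the terms of some expansion, rather than the coefficients, makes the bounds pass to
    sums and products with no regard to cancellation. *)
Definition lbounded (m : bool * bool -> int) (f : C -> C -> C) :=
  exists s : seq ((int * int) * C),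
    (forall t, t \in s -> forall b, sgWq b t.1 <= m b) /\
    forall z1 z2, z1 != 0 -> z2 != 0 ->
      f z1 z2 = \sum_(t <- s) t.2 * zmon z1 z2 t.1.

Lemma lbounded_zmon m c x : (forall b, sgWq b x <= m b) ->
  lbounded m (fun z1 z2 => c * zmon z1 z2 x).
Proof.
move=> mx; exists [:: (x, c)]; split=> [t|z1 z2 _ _]; last by rewrite big_seq1.
by rewrite inE => /eqP ->.
Qed.

Lemma lbounded_sum m (I : eqType) (r : seq I) (F : I -> C -> C -> C) :
  (forall i, i \in r -> lbounded m (F i)) ->
  lbounded m (fun z1 z2 => \sum_(i <- r) F i z1 z2).
Proof.
elim: r => [_|a r IHr Fm].
  by exists [::]; split=> // z1 z2 _ _; rewrite !big_nil.
have [|s [ms sE]] := IHr; first by move=> i ir; apply: Fm; rewrite inE ir orbT.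
have [|t [mt tE]] := Fm a; first by rewrite inE eqxx.
exists (t ++ s); split=> [u|z1 z2 z10 z20].
  by rewrite mem_cat => /orP[/mt|/ms].
by rewrite big_cons big_cat tE // sE.
Qed.

Lemma lbounded_prod (I : finType) (m : I -> bool * bool -> int)
    (F : I -> C -> C -> C) : (forall i, lbounded (m i) (F i)) ->
  lbounded (fun b => \sum_i m i b) (fun z1 z2 => \prod_i F i z1 z2).
Proof.
move=> Fm; elim: (index_enum I) => [|a r [s [ms sE]]].
  exists [:: (0, 1)]; split=> [t|z1 z2 _ _].
    by rewrite inE => /eqP -> b; rewrite big_nil /sgWq /weight /= !mulr0.
  by rewrite big_nil big_seq1 /zmon !expr0z !mulr1.
have [t [mt tE]] := Fm a.
exists [seq (x.1 + y.1, x.2 * y.2) | x <- t, y <- s]; split.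
  move=> _ /allpairsP[[x y] [/= /mt xm /ms ym ->]] b /=.
  by rewrite big_cons /sgWq weightD lerD //; [apply: xm | apply: ym].
move=> z1 z2 z10 z20; rewrite big_cons tE // sE // big_distrlr big_allpairs_dep /=.
by apply: eq_bigr => x _; apply: eq_bigr => y _; rewrite zmonD // mulrACA.
Qed.

Lemma lbounded_lcoefs m f : lbounded m f -> exists2 c, lcoefs f c &
  forall x, c x != 0 -> forall b, sgWq b x <= m b.
Proof.
move=> [s [ms fE]]; exists (fun p => \sum_(t <- s | t.1 == p) t.2).
  exact: (lcoefs_raw (e := fst) (a := snd)).
move=> x; have [/hasP[t ts /eqP <-] _|/hasPn no] := boolP (has (fun t => t.1 == x) s).
  exact: ms.
rewrite big_seq_cond big1 ?eqxx // => t /andP[/no/negPf ->] //.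
Qed.

(** A hop from site [i] to site [s i] carries an exponent of weight at most [wt i - wt (s i) + 1].
    Over a permutation the differences telescope, leaving the number [q1 q2] of sites. *)
Lemma lbounded_Pfloq V lam : lbounded (fun=> q1%:Z * q2%:Z) (@Pfloq C q1 q2 V lam).
Proof.
rewrite /Pfloq /determinant; apply: lbounded_sum => s _.
suff [r [mr rE]] : lbounded (fun=> q1%:Z * q2%:Z)
    (fun z1 z2 => \prod_i (Dmat q1 q2 V z1 z2 - lam%:M) i (s i)).
  exists [seq (t.1, (-1) ^+ s * t.2) | t <- r]; split=> [_ /mapP[t /mr tm ->] //|].
  move=> z1 z2 z10 z20; rewrite rE // mulr_sumr big_map.
  by apply: eq_bigr => t _; rewrite /= mulrA.
pose wt (b : bool * bool) (i : 'I_#|{: W q1 q2}|) := sgW b (posW (enum_val i)).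
have -> : (fun=> q1%:Z * q2%:Z) = fun b =>
    \sum_(i < #|{: W q1 q2}|) (wt b i - wt b (s i) + 1).
  apply: funext => b; have ws : \sum_i wt b (s i) = \sum_i wt b i.
    by rewrite [RHS](reindex_inj (@perm_inj _ s)).
  rewrite big_split sumrB /= ws subrr add0r.
  rewrite sumr_const card_ord cardW -PoszM natz //.
apply: (lbounded_prod (m := fun i b => wt b i - wt b (s i) + 1)) => i.
(* The index [None] stands for the diagonal term, [Some e] for the hop by [e]. *)
have -> : (fun z1 z2 => (Dmat q1 q2 V z1 z2 - lam%:M) i (s i)) = fun z1 z2 =>
   \sum_(o <- None :: map Some unit_steps)
     if o is Some e then
       (if modW (posW (enum_val i) + e) == enum_val (s i) then -1 else 0) *
       zmon z1 z2 (divW (posW (enum_val i) + e))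
     else (if i == s i then V (posW (enum_val i)) - lam else 0) * zmon z1 z2 0.
  apply: funext => z1; apply: funext => z2; rewrite !mxE DentryE [RHS]big_cons big_map.
  rewrite (inj_eq enum_val_inj) -addrA addrC -addrA [RHS]addrC -sumrN; congr (_ + _).
    by apply: eq_bigr => e _; case: ifP; rewrite ?mulN1r // mul0r oppr0.
  by rewrite /zmon !expr0z !mulr1; case: ifP; rewrite ?mulr0n ?mulr1n ?oppr0 ?add0r // addrC.
apply: lbounded_sum => -[e|] eu; last first.
  have [<-|_] := eqVneq i (s i); last first.
    by exists [::]; split=> // z1 z2 _ _; rewrite big_nil mul0r.
  apply: lbounded_zmon => b; rewrite subrr add0r /sgWq /weight /= !mulr0 addr0 //.
have [Ee|_] := eqVneq (modW _) _; last first.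
  by exists [::]; split=> // z1 z2 _ _; rewrite big_nil mul0r.
apply: lbounded_zmon => b; rewrite sgWqE.
have := congr1 (sgW b) (divW_eq (posW (enum_val i) + e)).
rewrite !sgWD Ee -/(wt b i) -/(wt b (s i)) => eqw.
suff : sgW b e <= 1 by lia.
move: eu; rewrite in_cons (mem_map Some_inj) => /unit_stepP eu.
by case: b {eqw} => -[] []; case: eu => ->.
Qed.

(** * Gauge transformation and one-parameter degenerations *)

Lemma gauge V lam (w1 w2 : C) : w1 != 0 -> w2 != 0 ->
  Pfloq q1 q2 V lam (w1 ^+ q1) (w2 ^+ q2) =
  \det (\matrix_(i < #|{: W q1 q2}|, j < #|{: W q1 q2}|)
    ((if i == j then V (posW (enum_val i)) - lam else 0) -
     \sum_(e <- unit_steps) if modW (posW (enum_val i) + e) == enum_val j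
                            then zmon w1 w2 e else 0)).
Proof.
move=> w10 w20; set H := \matrix_(_, _) _.
(* The diagonal matrix of the values [w^n] intertwines the two matrices; cancelling its determinant
   gives the claim. *)
pose D := \row_(i < #|{: W q1 q2}|) zmon w1 w2 (posW (enum_val i)).
have D0 : \det (diag_mx D) != 0.
  by rewrite det_diag; apply/prodf_neq0 => i _; rewrite mxE zmon_neq0.
apply: (mulIf D0); rewrite [RHS]mulrC -!det_mulmx; congr (\det _).
rewrite mul_mx_diag mul_diag_mx; apply/matrixP => i j; rewrite !mxE DentryE.
rewrite (inj_eq enum_val_inj) !mulrBr !mulrBl mulr_suml mulr_sumr addrAC.
congr (_ - _).
  case: eqP => [->|_]; last by rewrite mulr0n !(mul0r, mulr0) subrr.
  by rewrite mulr1n mulrBr ![zmon _ _ _ * _]mulrC.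
apply: eq_bigr => e _; case: eqP => [Ee|_]; last by rewrite mul0r mulr0.
rewrite -zmonD // [X in _ = zmon _ _ X]divW_eq Ee zmonD // mulrC; congr (_ * _).
by rewrite /zmon /= !exprnP !exprz_exp.
Qed.

(** This is [t H(w)] at [w = (k1 t^(-a), k2 t^(-b))]. For [|a|, |b| <= 1] the exponents
    [1 - weight a b e] are nonnegative on unit steps, so the absolute value only converts them to
    naturals. *)
Definition scaledD V lam (a b : int) (k1 k2 : C) : 'M[{poly C}]_(#|{: W q1 q2}|) :=
  \matrix_(i, j) ((if i == j then (V (posW (enum_val i)) - lam)%:P * 'X else 0) -
    \sum_(e <- unit_steps) if modW (posW (enum_val i) + e) == enum_val j
                           then zmon k1 k2 e *: 'X^`|(1 - weight a b e)%R| else 0).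

Lemma exprz_shift (s : C) (m k : int) : s != 0 -> k <= m ->
  s ^ m * s ^ (- k) = s ^+ `|(m - k)%R|%N.
Proof.
move=> s0 km; rewrite -expfzDr // exprnP gez0_abs //; lia.
Qed.

Lemma det_scaledD V lam (a b : int) (k1 k2 : C) c :
  k1 != 0 -> k2 != 0 -> `|a| <= 1 -> `|b| <= 1 -> lcoefs (Pfloq q1 q2 V lam) c ->
  (forall x, c x != 0 -> weight (a * q1%:Z) (b * q2%:Z) x <= q1%:Z * q2%:Z) ->
  exists s : seq (int * int), \det (scaledD V lam a b k1 k2) =
    \sum_(x <- s) (c x * zmon (k1 ^+ q1) (k2 ^+ q2) x) *:
      'X^`|(q1%:Z * q2%:Z - weight (a * q1%:Z) (b * q2%:Z) x)%R|.
Proof.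
move=> k10 k20 a1 b1 [s [_ _ cE]] cw; exists s.
(* Both sides are polynomials in [t], so it is enough to compare them at [t != 0], where [w] makes
   sense. *)
apply: eq_poly_nonzero => t t0.
pose w1 := k1 * t ^ (- a); pose w2 := k2 * t ^ (- b).
have w10 : w1 != 0 by rewrite mulf_neq0 // expfz_neq0.
have w20 : w2 != 0 by rewrite mulf_neq0 // expfz_neq0.
have zw x : zmon (t ^ (- a)) (t ^ (- b)) x = t ^ (- weight a b x).
  by rewrite /zmon !exprz_exp -expfzDr // /weight opprD !mulNr.
transitivity (t ^+ (q1 * q2) * Pfloq q1 q2 V lam (w1 ^+ q1) (w2 ^+ q2)).
  rewrite gauge // -cardW -detZ -[LHS]/(horner_eval t _) -det_map_mx.
  congr (\det _); apply/matrixP => i j; rewrite /scaledD !mxE.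
  rewrite -[LHS]/(horner _ t) hornerD hornerN horner_sum.
  rewrite mulrBr; congr (_ - _).
    by case: eqP => _; rewrite !hornerE // mulrC.
  rewrite mulr_sumr; apply: eq_big_seq => e eu; case: eqP => _;
    rewrite ?hornerZ ?hornerXn ?horner0 ?mulr0 //.
  rewrite /w1 /w2 zmonM zw mulrCA; congr (_ * _).
  rewrite -exprz_shift ?expr1z //.
  by case/unit_stepP: eu => ->; rewrite /weight /=; lia.
rewrite cE ?expf_neq0 // mulr_sumr horner_sum; apply: eq_bigr => x _.
rewrite hornerZ hornerXn; have [->|cx] := eqVneq (c x) 0; first by rewrite !mul0r mulr0.
rewrite /w1 /w2 !exprMn zmonM mulrCA -[RHS]mulrA; congr (_ * _).
rewrite mulrCA; congr (_ * _); rewrite -exprz_shift ?cw //.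
rewrite -PoszM exprnP; congr (_ * _).
rewrite /zmon !exprnP !exprz_exp -expfzDr //; congr (t ^ _); rewrite /weight; ring.
Qed.

Lemma shift_sum (f : W q1 q2 -> C) e w :
  \sum_n f n * (modW (posW n + e) == w)%:R = f (modW (posW w - e)).
Proof.
set m := modW _; have mE : modW (posW m + e) = w by rewrite modWD subrK posWK.
rewrite (bigD1 m) //= mE eqxx mulr1 big1 ?addr0 // => n nm.
by rewrite -mE (inj_eq (@modW_shift_inj e)) (negPf nm) mulr0.
Qed.

Lemma det_shift_neq0 e :
  \det (\matrix_(i < #|{: W q1 q2}|, j < #|{: W q1 q2}|)
    - (modW (posW (enum_val i) + e) == enum_val j)%:R : 'M[C]_(#|{: W q1 q2}|)) != 0.
Proof.
apply/negP => /det0P[v v0 vS]; case/negP: v0; apply/eqP/rowP => k; rewrite mxE.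
pose w := modW (posW (enum_val k) + e).
have := congr1 (fun u : 'rV_(#|{: W q1 q2}|) => u 0 (enum_rank w)) vS; rewrite !mxE.
under eq_bigr do rewrite mxE enum_rankK mulrN -[v 0 _](congr1 (v 0) (enum_valK _)).
rewrite sumrN (sum_enum_val (fun n => v 0 (enum_rank n) * (modW (posW n + e) == w)%:R)).
rewrite (shift_sum (fun n => v 0 (enum_rank n))) modWD addrK posWK enum_valK.
by move=> /eqP; rewrite oppr_eq0 => /eqP.
Qed.

(** In the direction of [e] the diamond attains its maximal weight only at this vertex. If the
    coefficient vanished there, the determinant of [scaledD] with [(a, b) = e] would be zero at
    [t = 0], where the matrix is the invertible [- S_e]. *)
Lemma vertex_neq0 (V : int * int -> C) lam e c : e \in unit_steps -> lcoefs (Pfloq q1 q2 V lam) c ->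
  (forall x, c x != 0 -> forall b, sgWq b x <= q1%:Z * q2%:Z) ->
  c (e.1 * q2%:Z, e.2 * q1%:Z) != 0.
Proof.
move=> eu Pc cb; apply/negP => /eqP cv0.
have cw x : c x != 0 -> weight (e.1 * q1%:Z) (e.2 * q2%:Z) x < q1%:Z * q2%:Z.
  move=> cx; have /= := cb x cx (false, false); have /= := cb x cx (false, true).
  have /= := cb x cx (true, false); have /= := cb x cx (true, true).
  rewrite /sgWq /weight /= expr0 expr1 => b1 b2 b3 b4.
  rewrite lt_neqAle; apply/andP; split; last by case/unit_stepP: eu => -> /=; lia.
  apply: contraNneq cx => wx; rewrite (surjective_pairing x); apply/eqP; rewrite -[RHS]cv0.
  have q10 : q1%:Z != 0 by lia.
  have q20 : q2%:Z != 0 by lia.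
  congr (c (_, _)); [apply: (mulfI q10) | apply: (mulfI q20)];
    by case/unit_stepP: eu wx => -> /=; lia.
have e1 : `|e.1| <= 1 by case/unit_stepP: eu => ->.
have e2 : `|e.2| <= 1 by case/unit_stepP: eu => ->.
have [s /(congr1 (horner_eval 0))] := det_scaledD (oner_neq0 C) (oner_neq0 C) e1 e2 Pc
  (fun x cx => ltW (cw x cx)).
rewrite -det_map_mx /horner_eval horner_sum big1 => [|x _]; last first.
  rewrite hornerZ hornerXn; have [->|cx] := eqVneq (c x) 0; first by rewrite !mul0r.
  by rewrite expr0n; case: eqP (cw x cx) => [|_]; rewrite ?mulr0 //; lia.
apply/eqP; set M := map_mx _ _; suff -> : M = \matrix_(i, j)
  - (modW (posW (enum_val i) + e) == enum_val j)%:R by exact: det_shift_neq0.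
apply/matrixP => i j; rewrite /scaledD !mxE -[LHS]/(horner _ 0) hornerD hornerN horner_sum.
rewrite (_ : horner _ _ = 0) ?add0r; last by case: eqP; rewrite !hornerE.
(* At [t = 0] only the step [e] survives, being the unit step with [1 - weight e.1 e.2 = 0]. *)
congr (- _); rewrite (bigD1_seq e) //= big1_seq ?addr0 => [|e' /andP[ee' eu']].
  case: eqP => _; rewrite ?hornerZ ?hornerXn ?horner0 // /zmon !exp1rz !mul1r.
  by case/unit_stepP: eu => ->.
case: eqP => _; rewrite ?hornerZ ?hornerXn ?horner0 // /zmon !exp1rz !mul1r.
by case/unit_stepP: eu ee' => ->; case/unit_stepP: eu' => ->; rewrite //= ?expr1n ?expr0n.
Qed.

Lemma Pfloq_diamond (V : int * int -> C) lam :
  exists2 c, lcoefs (Pfloq q1 q2 V lam) c & diamond q1 q2 c.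
Proof.
have [c Pc cb] := lbounded_lcoefs (lbounded_Pfloq V lam).
have sg (s : int) : `|s| = 1 -> exists b : bool, s = (-1) ^+ b.
  by move=> s1; exists (s == -1); case: eqP; rewrite ?expr0 ?expr1; lia.
exists c => //; split.
- by move=> s1 s2 /sg[b1 ->] /sg[b2 ->] x cx; apply: (cb x cx (b1, b2)).
- move=> s /sg[b ->].
  have := @vertex_neq0 V lam ((-1) ^+ b, 0) c _ Pc cb; rewrite /= mul0r; apply.
  by case: b.
- move=> s /sg[b ->].
  have := @vertex_neq0 V lam (0, (-1) ^+ b) c _ Pc cb; rewrite /= mul0r; apply.
  by case: b.
Qed.

(** * The difference of the two shifts and the linear coefficient *)

Hypothesis q12 : coprime q1 q2.

(** The periodic lift [F] is invariant under [(1, -1)]. By the Chinese remainder theorem some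
    multiple of [(1, -1)] moves any site to the origin modulo the periods. *)
Lemma shift_invariant_const (v : W q1 q2 -> C) :
  (forall n, v (modW (posW n + (1, 0))) = v (modW (posW n + (0, 1)))) ->
  forall n m, v n = v m.
Proof.
move=> vE; pose F x := v (modW x).
have F1 x : F (x + (1, -1)) = F x.
  have := vE (modW (x + (0, -1))); rewrite !modWD -!addrA.
  rewrite (_ : ((0, -1) : int * int) + (1, 0) = (1, -1)) //.
  by rewrite (_ : ((0, -1) : int * int) + (0, 1) = 0) // addr0.
have Fn x (k : nat) : F (x + (k%:Z, - k%:Z)) = F x.
  elim: k => [|k IHk]; first by rewrite (_ : (_, _) = 0) ?addr0.
  rewrite -IHk -[RHS]F1 -addrA; congr (F (x + _)).
  by rewrite [LHS]surjective_pairing [RHS]surjective_pairing /=; congr (_, _); lia.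
have Fk x (k : int) : F (x + (k, - k)) = F x.
  case: k => k; first exact: Fn.
  rewrite -(Fn _ k.+1) NegzE -addrA -[RHS](congr1 F (addr0 x)); congr (F (x + _)).
  by rewrite [LHS]surjective_pairing /=; congr (_, _); lia.
suff F0 n : v n = F 0 by move=> n m; rewrite !F0.
have q12z : coprimez q1%:Z q2%:Z by rewrite coprimezE.
rewrite -[n]posWK -/(F _); set x := posW n.
pose k := zchinese q1%:Z q2%:Z (- x.1) x.2.
rewrite -(Fk x k) /F; congr v; apply: posW_inj; rewrite !posW_modW /=.
congr (_, _).
  by rewrite -modzDmr zchinese_modl // modzDmr subrr.
by rewrite -modzDmr -modzNm zchinese_modr // modzNm modzDmr subrr.
Qed.

(** This is the value at [t = 0] of [scaledD] for [a = b = 1] and [(k1, k2) = (1, -1)]; the sign of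
    [k2] makes its row and column sums vanish. *)
Definition diffW : 'M[C]_(#|{: W q1 q2}|) := \matrix_(i, j)
  ((modW (posW (enum_val i) + (0, 1)) == enum_val j)%:R -
   (modW (posW (enum_val i) + (1, 0)) == enum_val j)%:R).

Lemma diffW_row_sum (v : 'rV[C]_(#|{: W q1 q2}|)) w :
  (v *m diffW) 0 (enum_rank w) =
  v 0 (enum_rank (modW (posW w - (0, 1)))) - v 0 (enum_rank (modW (posW w - (1, 0)))).
Proof.
rewrite mxE.
under eq_bigr do rewrite mxE enum_rankK -[v 0 _](congr1 (v 0) (enum_valK _)).
pose f n := v 0 (enum_rank n).
rewrite -[X in X - _](shift_sum f) -[X in _ - X](shift_sum f) -sumrB.
rewrite -sum_enum_val; apply: eq_bigr => i _.
by rewrite mulrBr.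
Qed.

Lemma diffW_ker (v : 'rV[C]_(#|{: W q1 q2}|)) :
  v *m diffW = 0 -> forall i j, v 0 i = v 0 j.
Proof.
move=> vD k l; rewrite -[k]enum_valK -[l]enum_valK.
apply: (shift_invariant_const (v := fun n => v 0 (enum_rank n))) => n.
(* The column [n + (1, 1)] compares the entries of [v] at [n + (1, 0)] and [n + (0, 1)]. *)
have := diffW_row_sum v (modW (posW n + (1, 1))).
rewrite vD mxE => /esym/eqP; rewrite subr_eq0 !modWD -!addrA => /eqP.
by rewrite (_ : ((1, 1) : int * int) - (0, 1) = (1, 0)) //
           (_ : ((1, 1) : int * int) - (1, 0) = (0, 1)).
Qed.

Lemma diffW_ker_col (v : 'cV[C]_(#|{: W q1 q2}|)) :
  diffW *m v = 0 -> forall i j, v i 0 = v j 0.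
Proof.
move=> Dv k l; rewrite -[k]enum_valK -[l]enum_valK.
apply: (shift_invariant_const (v := fun n => v (enum_rank n) 0)) => n.
have := congr1 (fun u : 'cV_(#|{: W q1 q2}|) => u (enum_rank n) 0) Dv; rewrite !mxE.
under eq_bigr do rewrite mxE enum_rankK mulrBl.
rewrite sumrB; have pick m : \sum_(k < #|{: W q1 q2}|) (m == enum_val k)%:R * v k 0 =
    v (enum_rank m) 0.
  rewrite (bigD1 (enum_rank m)) //= enum_rankK eqxx mul1r big1 ?addr0 // => h hm.
  by rewrite -[m in m == _]enum_rankK (inj_eq enum_val_inj) eq_sym (negPf hm) mul0r.
by rewrite !pick => /eqP; rewrite subr_eq0 => /eqP.
Qed.

Lemma const_diffW : const_mx 1 *m diffW = 0 :> 'rV[C]_(#|{: W q1 q2}|).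
Proof.
by apply/rowP => j; rewrite -[j]enum_valK diffW_row_sum !mxE subrr.
Qed.

Lemma det_diffW : \det diffW = 0.
Proof.
apply/eqP/det0P; exists (const_mx 1); last exact: const_diffW.
apply/eqP => /rowP /(_ (enum_rank (modW 0))); rewrite !mxE => /eqP.
by rewrite oner_eq0.
Qed.

(** Since [diffW] is singular, the rows of its adjugate lie in the left kernel and the columns in
    the right kernel; both kernels consist of constants. *)
Lemma cofactor_diffW i j k l : cofactor diffW i j = cofactor diffW k l.
Proof.
transitivity (cofactor diffW k j).
  have := diffW_ker (v := row j (\adj diffW)).
  rewrite -row_mul mul_adj_mx det_diffW => /(_ _ i k); rewrite !mxE; apply.
  by apply/rowP => m; rewrite !mxE mul0rn.
have Dk : diffW *m col k (\adj diffW) = 0.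
  by rewrite colE mulmxA mul_mx_adj det_diffW raddf0 mul0mx.
by have := diffW_ker_col Dk j l; rewrite !mxE.
Qed.

(* Replacing row i by the basis vector e_i turns the determinant into the
   (i, i) cofactor; since the row sums of diffW vanish, a left kernel vector of
   the new matrix has zero i-th entry, hence is a left kernel vector of diffW. *)
Lemma cofactor_diffW_neq0 i : cofactor diffW i i != 0.
Proof.
pose B := \matrix_(k, l) if k == i then (l == i)%:R else diffW k l.
have -> : cofactor diffW i i = \det B.
  rewrite (expand_det_row _ i) (bigD1 i) //= big1 => [|j ji]; last first.
    by rewrite mxE eqxx (negPf ji) mul0r.
  rewrite mxE !eqxx mul1r addr0; apply: eq_cofactor_row => k l ki.
  by rewrite [RHS]mxE (negPf ki).
have row_sum0 k : \sum_l diffW k l = 0.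
  under eq_bigr do rewrite mxE.
  have one m : \sum_(l < #|{: W q1 q2}|) (m == enum_val l)%:R = 1 :> C.
    rewrite (bigD1 (enum_rank m)) //= enum_rankK eqxx big1 ?addr0 // => l lm.
    by rewrite -[m in m == _]enum_rankK (inj_eq enum_val_inj) eq_sym (negPf lm).
  by rewrite sumrB !one subrr.
apply/negP => /det0P[v v0 vB].
have vi : v 0 i = 0.
  have : \sum_l (v *m B) 0 l = 0 by rewrite vB big1 // => l _; rewrite mxE.
  under eq_bigr do rewrite mxE.
  rewrite exchange_big (bigD1 i) //= [X in _ + X]big1 => [|k ki].
    rewrite addr0 (bigD1 i) //= mxE !eqxx mulr1 big1 ?addr0 // => l li.
    by rewrite mxE eqxx (negPf li) mulr0.
  under eq_bigr do rewrite mxE (negPf ki).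
  by rewrite -mulr_sumr row_sum0 mulr0.
(* A left kernel vector of [diffW] is constant, here with the value [v 0 i = 0]. *)
case/negP: v0; apply/eqP/rowP => j; rewrite mxE -vi.
apply: diffW_ker; rewrite -[RHS]vB; apply/rowP => l; rewrite !mxE.
apply: eq_bigr => k _; rewrite [in RHS]mxE.
by have [->|//] := eqVneq k i; rewrite vi !mul0r.
Qed.

(** For [a = b = 1] the hops carry the powers 0 and 2 of [t], so only the diagonal entries have a
    nonzero derivative at 0. Jacobi's formula then weights each [V - lam] with the common
    cofactor. *)
Lemma scaledD_coef1 (V : int * int -> C) lam :
  (\det (scaledD V lam 1 1 1 (-1)))`_1 =
  cofactor diffW (enum_rank (modW 0)) (enum_rank (modW 0)) *
  \sum_n (V (posW n) - lam).
Proof.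
set A := scaledD V lam 1 1 1 (-1).
have zmon_unit e : e \in unit_steps -> 'X^`|(1 - weight 1 1 e)%R|%N =
    (if (e == (1, 0)) || (e == (0, 1)) then 1 else 'X^2) :> {poly C}.
  by case/unit_stepP => ->.
have step0 (b : bool) e : e \in unit_steps ->
    (if b then zmon 1 (-1) e *: 'X^`|(1 - weight 1 1 e)%R| else 0 : {poly C})^`().[0] = 0.
  move=> eu; case: b; last by rewrite raddf0 horner0.
  rewrite zmon_unit // derivZ hornerZ; case: ifP => _.
    by rewrite (derivC 1 : 1^`() = 0 :> {poly C}) horner0 mulr0.
  by rewrite derivXn hornerMn hornerXn expr0n mul0rn mulr0.
have A0 : map_mx (horner_eval 0) A = diffW.
  apply/matrixP => i j; rewrite /A /scaledD !mxE -[LHS]/(horner _ 0) hornerD hornerN.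
  rewrite (_ : horner _ _ = 0) ?add0r; last by case: eqP; rewrite !hornerE.
  rewrite horner_sum (eq_big_seq (fun e : int * int =>
    (if (e == (1, 0)) || (e == (0, 1)) then zmon 1 (-1) e else 0) *
    (modW (posW (enum_val i) + e) == enum_val j)%:R)) => [|e eu].
    rewrite /unit_steps !big_cons big_nil /= !mul0r !add0r !addr0.
    by rewrite /zmon /= !exp1rz expr0z expr1z !mul1r mulN1r opprD opprK addrC.
  case: eqP => _; rewrite ?mulr1 ?mulr0 ?horner0 // hornerZ zmon_unit //.
  by case: ifP => _; rewrite ?hornerXn ?hornerC ?mulr1 // expr0n mulr0.
rewrite [LHS](_ : _ = (\det A)^`().[0]); last first.
  by rewrite horner_coef0 coef_deriv mulr1n.
rewrite deriv_det -[LHS]/(horner_eval 0 _) !raddf_sum /= mulr_sumr -sum_enum_val.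
apply: eq_bigr => i _; rewrite !raddf_sum (bigD1 i) //= big1 ?addr0 => [|j ji].
  rewrite rmorphM -cofactor_map_mx A0 mulrC; congr (_ * _); first exact: cofactor_diffW.
  rewrite /A /scaledD mxE eqxx -[LHS]/(horner _ 0) derivB hornerD hornerN.
  rewrite derivM derivC mul0r add0r derivX mulr1 hornerC.
  rewrite raddf_sum horner_sum big1_seq ?subr0 // => e /andP[_ eu].
  exact: step0.
rewrite rmorphM /A /scaledD mxE eq_sym (negPf ji) sub0r derivN -[X in X * _]/(horner _ 0) hornerN.
rewrite raddf_sum horner_sum big1_seq ?oppr0 ?mul0r // => e /andP[_ eu].
exact: step0.
Qed.

Lemma weights_mean (V : int * int -> C) lam c : lcoefs (Pfloq q1 q2 V lam) c ->
  (forall x, c x != 0 -> weight q1%:Z q2%:Z x <= q1%:Z * q2%:Z) ->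
  (forall x, c x != 0 -> exists j : int,
    weight q1%:Z q2%:Z x = q1%:Z * q2%:Z + 2%:Z * (q1%:Z * q2%:Z) * j) ->
  lam = meanV q1 q2 V.
Proof.
move=> Pc cw cj.
have one0 : 1 != 0 :> C := oner_neq0 _.
have mone0 : -1 != 0 :> C by rewrite oppr_eq0.
have one1 : `|1 : int| <= 1 by [].
have [|s sE] := det_scaledD one0 mone0 one1 one1 Pc.
  by move=> x cx; rewrite !mul1r; apply: cw.
have /eqP := scaledD_coef1 V lam; rewrite sE coef_sum big1 => [|x _]; last first.
  (* The assumed congruence makes every exponent [q1 q2 - weight] even, so none equals 1 and the
     linear coefficient vanishes. *)
  rewrite coefZ coefXn; have [->|cx] := eqVneq (c x) 0; first by rewrite !mul0r.
  have [j wj] := cj x cx; rewrite !mul1r wj; case: eqP => [|_]; last by rewrite mulr0.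
  set Q := _ * _; have -> : Q - (Q + 2%:Z * Q * j) = - (2%:Z * (Q * j)) by ring.
  lia.
rewrite eq_sym mulf_eq0 (negPf (cofactor_diffW_neq0 _)) /= sumrB subr_eq0 => /eqP sV.
have Q0 : (q1 * q2)%:R != 0 :> C by rewrite pnatr_eq0 -lt0n muln_gt0 q1_gt0.
apply: (mulfI Q0); rewrite /meanV mulrA mulfV // mul1r sV sumr_const cardW.
by rewrite mulr_natl.
Qed.

End FloquetMatrix.

Theorem floquet_irreducibility (C : numFieldType) (q1 q2 : nat) (V : int * int -> C) :
  (0 < q1)%N -> (0 < q2)%N -> coprime q1 q2 ->
  (forall lam, lam != meanV q1 q2 V -> lirreducible (Pfloq q1 q2 V lam)) /\
  forall lam, lreducible (Pfloq q1 q2 V lam) ->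
     exists f g : C -> C -> C,
       [/\ lirred_elem f, lirred_elem g, ~ lassociated f g
         & lfactors (Pfloq q1 q2 V lam) f g].
Proof.
move=> q1_gt0 q2_gt0 q12; split=> lam; have [c Pc cd] := Pfloq_diamond q1_gt0 q2_gt0 V lam.
  move=> /eqP lamV [f [g [fL gL fN gN Pfg]]]; apply: lamV.
  apply: (weights_mean q1_gt0 q2_gt0 q12 Pc).
    by case: cd => /(_ 1 1 erefl erefl) + _ _; rewrite !mul1r.
  exact: (reducible_weights q1_gt0 q2_gt0 q12 Pc cd fL gL Pfg fN gN).
move=> [f [g [fL gL fN gN Pfg]]]; exists f, g.
have Pgf : lfactors (Pfloq q1 q2 V lam) g f.
  by move=> z1 z2 z10 z20; rewrite mulrC Pfg.
split=> //.
- exact: (factor_irred q1_gt0 q2_gt0 q12 Pc cd fL gL Pfg).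
- exact: (factor_irred q1_gt0 q2_gt0 q12 Pc cd gL fL Pgf).
- exact: (factors_nonassociated q1_gt0 q2_gt0 q12 Pc cd fL gL Pfg).
Qed.

(** The monomials are the units of the Laurent polynomial ring, a unique factorization domain. Two
    distinct irreducible factors of multiplicity one thus amount to a product of two non-associated
    irreducible elements. *)
Theorem mainTheorem5 (R : realType) (q1 q2 : nat) (V : int * int -> R[i]) :
  (0 < q1)%N -> (0 < q2)%N -> coprime q1 q2 ->
  periodic2 q1 q2 V ->
  (forall lam : R[i], lam != meanV q1 q2 V ->
     lirreducible (Pfloq q1 q2 V lam)) /\
  (lreducible (Pfloq q1 q2 V (meanV q1 q2 V)) ->
     exists f g : R[i] -> R[i] -> R[i],
       [/\ lirred_elem f, lirred_elem g, ~ lassociated f g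
         & lfactors (Pfloq q1 q2 V (meanV q1 q2 V)) f g]).
Proof.
move=> q1_gt0 q2_gt0 q12 _.
have [irr red] := floquet_irreducibility V q1_gt0 q2_gt0 q12.
by split=> //; apply: red.
Qed.
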